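(* Let $(\Lambda,d)$ be a $k$-graph with no sources and, for $1\le i\le k$, let $\sigma^{e_i}:\Lambda^\infty\to\Lambda^\infty$ be the one-sided shift in the $e_i$ direction. Then the maps $\sigma^{e_i}$ and $\sigma^{e_j}$ $*$-commute for every $i\neq j$ if and only if $(\Lambda,d)$ is $1$-coaligned.
   Context: $\mathbb{N}=\{0,1,2,\dots\}$; $\mathbf{0}$ is the zero vector of $\mathbb{N}^k$, $e_1,\dots,e_k$ are the standard generators of $\mathbb{N}^k$, and $\le$ on $\mathbb{N}^k$ is the coordinatewise order. $*$-commuting: for a set $X$ and commuting functions $S,T:X\to X$, we say $S$ and $T$ $*$-commute if for every $(y,z)\in X\times X$ with $S(y)=T(z)$ there exists a unique $x\in X$ such that $T(x)=y$ and $S(x)=z$. (So $*$-commuting includes $ST=TS$.) $k$-graph: for $k\ge 1$, a $k$-graph is a pair $(\Lambda,d)$ consisting of a countable category $\Lambda$ and a functor $d:\Lambda\to\mathbb{N}^k$ (the degree map; $\mathbb{N}^k$ is regarded as a monoid under addition) satisfying the factorization property: for every $\lambda\in\Lambda$ and $m,n\in\mathbb{N}^k$ with $d(\lambda)=m+n$ there are unique $\mu,\nu\in\Lambda$ with $d(\mu)=m$, $d(\nu)=n$ and $\lambda=\mu\nu$. Elements of $\Lambda$ are the morphisms (paths), $r$ and $s$ denote range (codomain) and source (domain), and $\mu\nu$ is defined when $s(\mu)=r(\nu)$. For $n\in\mathbb{N}^k$, $\Lambda^n:=\{\lambda\in\Lambda: d(\lambda)=n\}$; $\Lambda^{\mathbf{0}}$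 is the set of identity morphisms, identified with the objects (vertices), also written $\Lambda^0$. Infinite paths: $\Omega_k$ is the $k$-graph with object set $\mathbb{N}^k$, morphisms $\{(m,n)\in\mathbb{N}^k\times\mathbb{N}^k: m\le n\}$, $r(m,n)=m$, $s(m,n)=n$, composition $(m,n)(n,p)=(m,p)$, and degree $d(m,n)=n-m$. A morphism of $k$-graphs is a functor compatible with the degree maps. The infinite path space is $\Lambda^\infty:=\{x:\Omega_k\to\Lambda : x \text{ is a } k\text{-graph morphism}\}$. For $x\in\Lambda^\infty$, $r(x):=x(\mathbf{0},\mathbf{0})$. For $p\in\mathbb{N}^k$ the shift $\sigma^p:\Lambda^\infty\to\Lambda^\infty$ is $\sigma^p(x)(m,n)=x(m+p,n+p)$. No sources: for every $v\in\Lambda^0$ there exists $x\in\Lambda^\infty$ with $r(x)=v$. $1$-coaligned: $\Lambda$ is $1$-coaligned if for all $1\le i,j\le k$ with $i\ne j$ and all $(e^i,e^j)\in\Lambda^{e_i}\times\Lambda^{e_j}$ with $s(e^i)=s(e^j)$ there exists a unique pair $(f^i,f^j)\in\Lambda^{e_i}\times\Lambda^{e_j}$ such that $f^ie^j=f^je^i$. *)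

(* Defs.v *)
From mathcomp Require Import all_boot ssralg.
Set Implicit Arguments.
Unset Strict Implicit.
Unset Printing Implicit Defensive.
Import GRing.Theory.
Local Open Scope ring_scope.

Definition star_commute (X : Type) (S T : X -> X) : Prop :=
  (forall x, S (T x) = T (S x)) /\
  (forall y z, S y = T z -> exists! x, T x = y /\ S x = z).

(* The commutative monoid N^k; {ffun _} makes extensional equality Leibniz. *)
Notation natv k := {ffun 'I_k -> nat}.

Definition lev k (m n : natv k) : bool := [forall i, (m i <= n i)%N].
Definition subv k (n m : natv k) : natv k := [ffun i => (n i - m i)%N].
Definition genv k (i : 'I_k) : natv k := [ffun j => (j == i : nat)].

Lemma levP k (m n : natv k) : reflect (forall i, (m i <= n i)%N) (lev m n).
Proof. exact: forallP. Qed.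

Lemma lev_refl k (m : natv k) : lev m m.
Proof. exact/levP. Qed.

Lemma lev_trans k (n m p : natv k) : lev m n -> lev n p -> lev m p.
Proof. by move=> /levP h1 /levP h2; apply/levP => i; apply: leq_trans (h2 i). Qed.

Lemma lev_add2r k (p m n : natv k) : lev m n -> lev (m + p) (n + p).
Proof. by move=> /levP h; apply/levP => i; rewrite !ffunE leq_add2r. Qed.

(* A countable small category. [comp f g] is the composite fg, meaningful only
   when [src f = rng g]; its value on other pairs is arbitrary and no axiom
   constrains it, so every later use of [comp] carries composability. *)
Record category := Category {
  obj : countType;
  mor : countType;
  rng : mor -> obj;
  src : mor -> obj;
  idm : obj -> mor;
  comp : mor -> mor -> mor;
  rng_idm : forall a, rng (idm a) = a;
  src_idm : forall a, src (idm a) = a;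
  rng_comp : forall f g, src f = rng g -> rng (comp f g) = rng f;
  src_comp : forall f g, src f = rng g -> src (comp f g) = src g;
  comp_idl : forall f, comp (idm (rng f)) f = f;
  comp_idr : forall f, comp f (idm (src f)) = f;
  compA : forall f g h, src f = rng g -> src g = rng h ->
    comp f (comp g h) = comp (comp f g) h
}.

Arguments rng {c} _.
Arguments src {c} _.
Arguments idm {c} _.
Arguments comp {c} _ _.

Record functor (C D : category) := Functor {
  fobj : obj C -> obj D;
  fmor : mor C -> mor D;
  fmor_rng : forall f, rng (fmor f) = fobj (rng f);
  fmor_src : forall f, src (fmor f) = fobj (src f);
  fmor_idm : forall a, fmor (idm a) = idm (fobj a);
  fmor_comp : forall f g, src f = rng g ->
    fmor (comp f g) = comp (fmor f) (fmor g)
}.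

Record kgraph (k : nat) := KGraph {
  kcat :> category;
  deg : mor kcat -> natv k;
  deg_idm : forall a, deg (idm a) = 0;
  deg_comp : forall f g, src f = rng g -> deg (comp f g) = deg f + deg g;
  factorization : forall (l : mor kcat) (m n : natv k), deg l = m + n ->
    exists! p : mor kcat * mor kcat,
      [/\ deg p.1 = m, deg p.2 = n, src p.1 = rng p.2 & l = comp p.1 p.2]
}.

Arguments deg {k L} _ : rename.

Record kmorphism k (L M : kgraph k) := KMorphism {
  kfunctor :> functor L M;
  kmor_deg : forall f, deg (fmor kfunctor f) = deg f
}.

Section Omega.
Variable k : nat.

Definition omor := {p : natv k * natv k | lev p.1 p.2}.
Definition omk (m n : natv k) (h : lev m n) : omor := exist _ (m, n) h.
Definition orng (f : omor) : natv k := (val f).1.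
Definition osrc (f : omor) : natv k := (val f).2.
Definition oidm (m : natv k) : omor := omk (lev_refl m).

(* (m,n)(n,p) = (m,p); [insubd f] returns the junk value f on
   non-composable pairs for which (m,p) is not a morphism. *)
Definition ocomp (f g : omor) : omor := insubd f (orng f, osrc g).
Definition odeg (f : omor) : natv k := subv (osrc f) (orng f).

Lemma val_ocomp f g : osrc f = orng g -> val (ocomp f g) = (orng f, osrc g).
Proof.
move=> e; rewrite val_insubd /=.
by rewrite (lev_trans (valP f)) // -/(osrc f) e; apply: (valP g).
Qed.

Lemma orng_comp f g : osrc f = orng g -> orng (ocomp f g) = orng f.
Proof. by move=> e; rewrite /orng val_ocomp. Qed.
Lemma osrc_comp f g : osrc f = orng g -> osrc (ocomp f g) = osrc g.
Proof. by move=> e; rewrite /osrc val_ocomp. Qed.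
Lemma ocomp_idl f : ocomp (oidm (orng f)) f = f.
Proof. by apply: val_inj; rewrite val_ocomp //; case: f => -[]. Qed.
Lemma ocomp_idr f : ocomp f (oidm (osrc f)) = f.
Proof. by apply: val_inj; rewrite val_ocomp //; case: f => -[]. Qed.
Lemma ocompA f g h : osrc f = orng g -> osrc g = orng h ->
  ocomp f (ocomp g h) = ocomp (ocomp f g) h.
Proof.
move=> e1 e2; apply: val_inj.
by rewrite !val_ocomp ?orng_comp ?osrc_comp.
Qed.

Definition Omega_cat : category :=
  @Category (natv k) omor orng osrc oidm ocomp
    (fun=> erefl) (fun=> erefl) orng_comp osrc_comp ocomp_idl ocomp_idr ocompA.

Lemma odeg_idm m : odeg (oidm m) = 0.
Proof. by apply/ffunP => i; rewrite !ffunE subnn. Qed.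

Lemma osrcE f : osrc f = orng f + odeg f.
Proof.
by apply/ffunP => i; have /levP/(_ i) h := valP f; rewrite !ffunE;
  exact/esym/subnKC.
Qed.

Lemma addvI (a b c : natv k) : a + b = a + c -> b = c.
Proof. by move=> /ffunP h; apply/ffunP => i; have := h i; rewrite !ffunE => /addnI. Qed.

Lemma odeg_comp f g : osrc f = orng g -> odeg (ocomp f g) = odeg f + odeg g.
Proof.
move=> e; apply: (@addvI (orng f)).
by rewrite addrA -osrcE e -osrcE -{1}(orng_comp e) -osrcE osrc_comp.
Qed.

Lemma lev_addr (a b : natv k) : lev a (a + b).
Proof. by apply/levP => i; rewrite !ffunE leq_addr. Qed.

Lemma odeg_omk (a b : natv k) : odeg (omk (lev_addr a b)) = b.
Proof. by apply: (@addvI a); rewrite -[RHS]/(osrc (omk (lev_addr a b))) osrcE. Qed.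

Lemma omor_inj f g : orng f = orng g -> odeg f = odeg g -> f = g.
Proof.
move=> e1 e2; apply: val_inj.
rewrite [LHS]surjective_pairing [RHS]surjective_pairing.
by rewrite -/(orng f) -/(orng g) -/(osrc f) -/(osrc g) !osrcE e1 e2.
Qed.

Lemma ofactorization (l : omor) (m n : natv k) : odeg l = m + n ->
  exists! p : omor * omor,
    [/\ odeg p.1 = m, odeg p.2 = n, osrc p.1 = orng p.2 & l = ocomp p.1 p.2].
Proof.
move=> dl; pose a := orng l.
exists (omk (lev_addr a m), omk (lev_addr (a + m) n)); split=> /=.
  split; rewrite ?odeg_omk //.
  apply: omor_inj; first by rewrite orng_comp.
  by rewrite odeg_comp // !odeg_omk.
case=> u v /= [du dv uv lE].
have ru : orng u = a by rewrite /a lE orng_comp.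
by congr pair; apply: omor_inj; rewrite ?odeg_omk // -uv osrcE ru du.
Qed.

Definition Omega : kgraph k :=
  @KGraph k Omega_cat odeg odeg_idm odeg_comp ofactorization.

Variable p : natv k.

(* The functor (m,n) |-> (m+p,n+p) from Omega_k to itself. *)
Definition otrans (f : omor) : omor := omk (lev_add2r p (valP f)).

Lemma otrans_idm a : otrans (oidm a) = oidm (a + p).
Proof. exact: val_inj. Qed.

Lemma otrans_comp f g : osrc f = orng g ->
  otrans (ocomp f g) = ocomp (otrans f) (otrans g).
Proof.
move=> e; apply: val_inj; rewrite val_ocomp; last by congr (_ + p).
by rewrite /= val_ocomp.
Qed.

Definition otransF : functor Omega Omega :=
  @Functor Omega Omega (fun a => a + p) otrans (fun=> erefl) (fun=> erefl)
    otrans_idm otrans_comp.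

Lemma otrans_deg f : odeg (otrans f) = odeg f.
Proof. by apply/ffunP => i; rewrite !ffunE subnDr. Qed.

Definition translation : kmorphism Omega Omega :=
  @KMorphism k Omega Omega otransF otrans_deg.

End Omega.

Section Compose.
Variables (k : nat) (L M N : kgraph k).
Variables (G : kmorphism M N) (F : kmorphism L M).

Let gf (f : mor L) : mor N := fmor G (fmor F f).

Lemma kcompose_rng f : rng (gf f) = fobj G (fobj F (rng f)).
Proof. by rewrite /gf !fmor_rng. Qed.
Lemma kcompose_src f : src (gf f) = fobj G (fobj F (src f)).
Proof. by rewrite /gf !fmor_src. Qed.
Lemma kcompose_idm a : gf (idm a) = idm (fobj G (fobj F a)).
Proof. by rewrite /gf !fmor_idm. Qed.
Lemma kcompose_comp f g : src f = rng g -> gf (comp f g) = comp (gf f) (gf g).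
Proof. by move=> e; rewrite /gf !fmor_comp // fmor_src fmor_rng e. Qed.
Lemma kcompose_deg f : deg (gf f) = deg f.
Proof. by rewrite /gf !kmor_deg. Qed.

Definition kcompose : kmorphism L N :=
  @KMorphism k L N
    (@Functor L N (fun a => fobj G (fobj F a)) gf
       kcompose_rng kcompose_src kcompose_idm kcompose_comp)
    kcompose_deg.

End Compose.

Definition infpath k (L : kgraph k) := kmorphism (Omega k) L.

(* [ipeval x h] is x(m,n). *)
Definition ipeval k (L : kgraph k) (x : infpath L) (m n : natv k)
  (h : lev m n) : mor L := @fmor (Omega k) L x (omk h).

Definition iprange k (L : kgraph k) (x : infpath L) : mor L :=
  ipeval x (lev_refl 0).

Definition shift k (L : kgraph k) (p : natv k) (x : infpath L) : infpath L :=
  kcompose x (translation p).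

Lemma shiftE k (L : kgraph k) (p : natv k) (x : infpath L) (m n : natv k)
    (h : lev m n) :
  ipeval (shift p x) h = ipeval x (lev_add2r p h).
Proof.
by rewrite /ipeval (_ : omk (lev_add2r p h) = otrans p (omk h)) //; apply: val_inj.
Qed.

(* Vertices are the degree-zero morphisms, and r(x) = x(0,0) is one of them. *)
Definition no_sources k (L : kgraph k) : Prop :=
  forall v : mor L, deg v = 0 -> exists x : infpath L, iprange x = v.

(* The two source/range conditions on the pair say that both composites in
   f^i e^j = f^j e^i are defined. *)
Definition one_coaligned k (L : kgraph k) : Prop :=
  forall i j : 'I_k, i != j ->
  forall ei ej : mor L, deg ei = genv i -> deg ej = genv j ->
  src ei = src ej ->
  exists! f : mor L * mor L,
    [/\ deg f.1 = genv i, deg f.2 = genv j,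
        src f.1 = rng ej, src f.2 = rng ei & comp f.1 ej = comp f.2 ei].

(* Main.v *)
Require Import Defs.
From mathcomp Require Import all_boot ssralg.
From Stdlib Require Import FunctionalExtensionality ProofIrrelevance.
Set Implicit Arguments.
Unset Strict Implicit.
Unset Printing Implicit Defensive.

(** An infinite path [x] is determined by its initial segments [init x n],
    the values x(0,n), and an increasing family of segments, one in each degree,
    comes from an infinite path ([path_of_segments]); both facts rest on
    cancellation in [L], which is the uniqueness of factorizations.  Consequently
    a finite path [l] can be put in front of any infinite path [x] that starts
    where [l] ends ([prepend]), and the result is the only infinite path with
    first segment [l] and shift [x] ([init_shift_inj]).

    Fix degrees p, q and infinite paths y, z with a common tail
    sigma^p y = sigma^q z.  If sigma^q x = y and sigma^p x = z, then the segment
    x(0,p+q) factors both as x(0,p) z(0,q) and as x(0,q) y(0,p), so x yields a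
    commuting square with two given sides y(0,p), z(0,q).  Conversely, such a
    square with new sides f, g determines x, namely y with g put in front: its
    shift by p has first segment z(0,q) and then the same tail as z, so it is z.
    This correspondence ([lift_square_iff]) turns unique completion of infinite
    paths into unique completion of squares.  For p = e_i and q = e_j the first
    is *-commutation and the second 1-coalignment, provided that every pair of
    edges with a common source occurs as (y(0,e_i), z(0,e_j)); that is where the
    absence of sources enters, as it gives an infinite path to serve as tail. *)

Section InfinitePaths.
Import GRing.Theory.
Local Open Scope ring_scope.

(* Composition in a category, as opposed to composition of functions. *)
Local Notation comp := Defs.comp.

Variables (k : nat) (L : kgraph k).
Implicit Types (x y z : infpath L) (n m p q : natv k) (a b f g l : mor L).

(** * Cancellation and factorization of finite paths *)

(** Uniqueness of factorizations: [deg a = deg a'] forces [deg b = deg b'], so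
    the two composites factor one path at the same pair of degrees. *)
Lemma comp_inj a b a' b' :
  src a = rng b -> src a' = rng b' -> deg a = deg a' ->
  comp a b = comp a' b' -> a = a' /\ b = b'.
Proof.
move=> ab ab' da e.
have db : deg b = deg b'.
  by apply: (@addvI _ (deg a)); rewrite {2}da -!deg_comp // e.
have [u [_ uP]] := factorization (deg_comp ab).
have e1 : u = (a, b) by apply: uP.
have e2 : u = (a', b') by apply: uP.
by move: e2; rewrite e1 => -[].
Qed.

Lemma deg0_idm a : deg a = 0 -> a = idm (rng a).
Proof.
move=> da.
have [] // := @comp_inj a (idm (src a)) (idm (rng a)) a.
- by rewrite rng_idm.
- by rewrite src_idm.
- by rewrite deg_idm.
- by rewrite comp_idl comp_idr.
Qed.

Definition prefix a l := exists2 t, src a = rng t & l = comp a t.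

Lemma prefix_trans a b l : prefix a b -> prefix b l -> prefix a l.
Proof.
move=> [t at_ ->] [u]; rewrite src_comp // => tu ->.
by exists (comp t u); [rewrite rng_comp | rewrite Defs.compA].
Qed.

Lemma prefix_deg_inj a b l :
  prefix a l -> prefix b l -> deg a = deg b -> a = b.
Proof. by move=> [t at_ ->] [u bu e] d; case: (comp_inj at_ bu d e). Qed.

Lemma prefix_exists l m n : deg l = m + n -> exists2 a, deg a = m & prefix a l.
Proof.
move=> /factorization [[a b] [/= [da db ab e] _]].
by exists a => //; exists b.
Qed.

(** The longer prefix factors at the smaller degree; its initial factor is a
    prefix of the whole path too, so by uniqueness it is the shorter prefix. *)
Lemma prefix_lev a b l :
  prefix a l -> prefix b l -> lev (deg a) (deg b) -> prefix a b.
Proof.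
move=> al bl /levP ab.
have db : deg b = deg a + subv (deg b) (deg a).
  by apply/ffunP => i; rewrite !ffunE; exact/esym/subnKC.
have [c dc cb] := prefix_exists db.
by rewrite (prefix_deg_inj al (prefix_trans cb bl)).
Qed.

(** * Infinite paths and their initial segments *)

Lemma lev0 n : lev 0 n.
Proof. by apply/levP => i; rewrite ffunE. Qed.

Definition init x n : mor L := ipeval x (lev0 n).

Lemma rng_init x n : rng (init x n) = fobj x 0.
Proof. exact: fmor_rng. Qed.

Lemma src_init x n : src (init x n) = fobj x n.
Proof. exact: fmor_src. Qed.

Lemma deg_init x n : deg (init x n) = n.
Proof.
by rewrite /init /ipeval kmor_deg; apply/ffunP => i; rewrite !ffunE subn0.
Qed.

Lemma iprangeE x : iprange x = idm (fobj x 0).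
Proof. exact: (fmor_idm x). Qed.

(** Two equal maps on morphisms agree on objects, which are recovered as the
    ranges of identities; the functoriality proofs are then identified by proof
    irrelevance. *)
Lemma infpath_ext x y : @fmor (Omega k) L x =1 @fmor (Omega k) L y -> x = y.
Proof.
move=> /functional_extensionality; case: x y => F dF [G dG] /= eFG.
suff FG : F = G by case: _ / FG dG => dG; congr KMorphism; exact: proof_irrelevance.
have eobj : @fobj (Omega k) L F = @fobj (Omega k) L G.
  apply: functional_extensionality => n.
  by rewrite -[LHS]rng_idm -[RHS]rng_idm -!fmor_idm eFG.
case: F G {dF dG} eFG eobj => [fo fm h1 h2 h3 h4] [go gm h1' h2' h3' h4'] /= eFG eobj.
case: _ / eFG h1' h2' h3' h4' => h1' h2' h3' h4'.
case: _ / eobj h1' h2' h3' h4' => *.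
by congr Functor; apply: proof_irrelevance.
Qed.

Lemma init_segment x (f : omor k) :
  init x (osrc f) = comp (init x (orng f)) (@fmor (Omega k) L x f).
Proof.
rewrite /init /ipeval -(@fmor_comp (Omega k) L x) //.
by congr (fmor _ _); apply: val_inj; rewrite val_ocomp.
Qed.

Lemma src_init_segment x (f : omor k) :
  src (init x (orng f)) = rng (@fmor (Omega k) L x f).
Proof. by rewrite src_init fmor_rng. Qed.

(** The segment x(m,n) is what remains of x(0,n) after cancelling x(0,m). *)
Lemma init_inj x y : init x =1 init y -> x = y.
Proof.
move=> e; apply: infpath_ext => f.
have h := init_segment x f; rewrite !e (init_segment y f) in h.
have xy : src (init y (orng f)) = rng (@fmor (Omega k) L x f).
  by rewrite -e src_init_segment.
by case: (comp_inj xy (src_init_segment y f) erefl (esym h)).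
Qed.

Lemma prefix_init x m n : lev m n -> prefix (init x m) (init x n).
Proof.
move=> h; exists (ipeval x h); first exact: (src_init_segment x (omk h)).
exact: (init_segment x (omk h)).
Qed.

Lemma fobj_shift p x : fobj (shift p x) 0 = fobj x p.
Proof. by rewrite /= add0r. Qed.

Lemma init_add x p n : init x (p + n) = comp (init x p) (init (shift p x) n).
Proof.
have h : lev p (p + n) by exact: lev_addr.
rewrite (init_segment x (omk h)); congr comp.
rewrite /init shiftE /ipeval; congr (fmor _ _).
by apply: val_inj; rewrite /= add0r addrC.
Qed.

Lemma src_init_shift x p n : src (init x p) = rng (init (shift p x) n).
Proof. by rewrite src_init rng_init fobj_shift. Qed.

Lemma shiftC p q x : shift p (shift q x) = shift q (shift p x).
Proof.
apply: infpath_ext => f /=; congr (fmor _ _).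
by apply: val_inj; rewrite /= addrAC [X in (_, X)]addrAC.
Qed.

(** x(0,n) is the prefix of degree n of x(0,p+n), and x(0,p+n) is x(0,p)
    followed by an initial segment of the shift. *)
Lemma init_shift_inj p x y :
  init x p = init y p -> shift p x = shift p y -> x = y.
Proof.
move=> e1 e2; apply: init_inj => n.
apply: (@prefix_deg_inj _ _ (init x (p + n))); last by rewrite !deg_init.
  by apply: prefix_init; rewrite addrC lev_addr.
rewrite init_add e1 e2 -init_add.
by apply: prefix_init; rewrite addrC lev_addr.
Qed.

(** * Building infinite paths *)

(** The value at (m,n) has to be the complement of [c m] in [c n]; cancellation
    makes this choice unique, hence functorial. *)
Lemma path_of_segments (c : natv k -> mor L) :
  (forall n, deg (c n) = n) ->
  (forall m n, lev m n -> prefix (c m) (c n)) ->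
  exists x, forall n, init x n = c n.
Proof.
move=> dc cc.
have H (f : omor k) :
    exists t, (src (c (orng f)) == rng t) && (c (osrc f) == comp (c (orng f)) t).
  have [t h1 h2] := cc _ _ (valP f).
  by exists t; apply/andP; split; apply/eqP.
pose F (f : omor k) := xchoose (H f).
have Fr (f : omor k) : rng (F f) = src (c (orng f)) by have /andP[/eqP] := xchooseP (H f).
have Fc (f : omor k) : c (osrc f) = comp (c (orng f)) (F f).
  by have /andP[_ /eqP] := xchooseP (H f).
have Fs (f : omor k) : src (F f) = src (c (osrc f)) by rewrite Fc src_comp.
have Funique (f : omor k) t : src (c (orng f)) = rng t -> c (osrc f) = comp (c (orng f)) t ->
    F f = t.
  by move=> rt; rewrite Fc => /comp_inj [].
have Fi n : F (oidm n) = idm (src (c n)).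
  by apply: Funique; rewrite ?rng_idm ?comp_idr.
have Fm (f g : omor k) : osrc f = orng g -> F (ocomp f g) = comp (F f) (F g).
  move=> fg.
  have FfFg : src (F f) = rng (F g) by rewrite Fs Fr fg.
  apply: Funique; rewrite orng_comp // ?rng_comp // osrc_comp // Defs.compA //.
  by rewrite -Fc fg -Fc.
have Fd (f : omor k) : deg (F f) = odeg f.
  apply: (@addvI _ (orng f)).
  by rewrite -osrcE -[RHS]dc Fc deg_comp // dc.
exists (@KMorphism _ _ _ (@Functor (Omega k) L (fun n => src (c n)) F Fr Fs Fi Fm) Fd).
(* The segment (0,n) was built as the complement of [c 0] in [c n], and [c 0]
   is an identity. *)
move=> n; have c0 := deg0_idm (dc 0).
have r0 : rng (F (omk (lev0 n))) = rng (c 0).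
  by rewrite Fr /orng /= c0 src_idm rng_idm.
have /= := Fc (omk (lev0 n)).
by rewrite /osrc /orng /= c0 -r0 comp_idl.
Qed.

(** The segment of degree n of the new path is the prefix of degree n of
    l x(0,n), which is long enough, having degree n + deg l.  These prefixes are
    nested because the paths l x(0,n) are. *)
Lemma prepend l x :
  src l = fobj x 0 -> exists y, init y (deg l) = l /\ shift (deg l) y = x.
Proof.
move=> lx; set p := deg l.
have lxn n : src l = rng (init x n) by rewrite rng_init.
have dl n : deg (comp l (init x n)) = n + p.
  by rewrite deg_comp // deg_init addrC.
have mono m n : lev m n -> prefix (comp l (init x m)) (comp l (init x n)).
  move=> /(prefix_init x) [t mt ->].
  by exists t; rewrite ?src_comp // Defs.compA.
have H n : exists t : mor L * mor L,
    [&& deg t.1 == n, src t.1 == rng t.2 & comp l (init x n) == comp t.1 t.2].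
  have [a da [t at_ e]] := prefix_exists (dl n).
  by exists (a, t); rewrite /= da at_ e !eqxx.
pose c n := (xchoose (H n)).1.
have dc n : deg (c n) = n by have /and3P[/eqP] := xchooseP (H n).
have cP n : prefix (c n) (comp l (init x n)).
  by have /and3P[_ /eqP ? /eqP ?] := xchooseP (H n); exists (xchoose (H n)).2.
have [|y yc] := path_of_segments dc.
  move=> m n mn; apply: (@prefix_lev _ _ (comp l (init x n))) => //.
    exact: prefix_trans (cP m) (mono _ _ mn).
  by rewrite !dc.
have yp : init y p = l.
  rewrite yc; apply: (prefix_deg_inj (cP p)); last by rewrite dc.
  by exists (init x p).
exists y; split=> //; apply: init_inj => n.
have e : init y (p + n) = comp l (init x n).
  rewrite yc addrC; apply: (prefix_deg_inj (cP _)).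
    by apply: mono; exact: lev_addr.
  by rewrite dl dc.
have ln : src l = rng (init (shift p y) n) by rewrite -yp; exact: src_init_shift.
by move: e; rewrite init_add yp => /(comp_inj ln (lxn n)) [].
Qed.

(** * Commuting squares *)

Definition square f g a b :=
  [/\ src f = rng b, src g = rng a & comp f b = comp g a].

Lemma square_of_path p q x :
  square (init x p) (init x q) (init (shift q x) p) (init (shift p x) q).
Proof. by split; rewrite -?init_add 1?addrC //; exact: src_init_shift. Qed.

(** The path is y with g in front.  Cancelling in the path of degree p+q shows
    that its shift by p starts with the first q-segment of z; beyond that segment
    it agrees with z because the shifts commute. *)
Lemma path_of_square p q y z f g :
  shift p y = shift q z -> deg f = p -> deg g = q ->
  square f g (init y p) (init z q) ->
  exists x, [/\ shift q x = y, shift p x = z, init x p = f & init x q = g].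
Proof.
move=> yz df dg [fz gy e].
have [|x []] := @prepend g y; first by rewrite gy rng_init.
rewrite dg => xq xy.
have [fx zx] : init x p = f /\ init (shift p x) q = init z q.
  apply: (comp_inj (src_init_shift x p q) fz); first by rewrite deg_init.
  by rewrite -init_add addrC init_add xq xy.
exists x; split=> //.
by apply: (init_shift_inj zx); rewrite shiftC xy.
Qed.

(** A lift x gives the square with new sides x(0,p) and x(0,q), and every square
    arises from a lift.  The lift is recovered from the side x(0,q) alone, since
    its shift by q is the given y, so uniqueness transfers in both directions. *)
Lemma lift_square_iff p q y z : shift p y = shift q z ->
  (exists! x, shift q x = y /\ shift p x = z) <->
  (exists! fg : mor L * mor L, [/\ deg fg.1 = p, deg fg.2 = q
     & square fg.1 fg.2 (init y p) (init z q)]).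
Proof.
move=> yz; split.
  move=> [x [[xy xz] xu]]; exists (init x p, init x q); split.
    by rewrite !deg_init -xy -xz; split=> //; exact: square_of_path.
  move=> [f g] /= [df dg sq].
  have [x' [x'y x'z <- <-]] := path_of_square yz df dg sq.
  by rewrite (xu x').
move=> [[f g] [/= [df dg sq] fgu]].
have [x [xy xz _ xg]] := path_of_square yz df dg sq.
exists x; split=> // x' [x'y x'z].
have [_ x'g] : (f, g) = (init x' p, init x' q).
  by apply: fgu; rewrite /= !deg_init -x'y -x'z; split=> //; exact: square_of_path.
by apply: (@init_shift_inj q); rewrite ?xy // xg.
Qed.

End InfinitePaths.

Theorem theorem2p3 (k : nat) (hk : 0 < k) (L : kgraph k) (hL : no_sources L) :
  (forall i j : 'I_k, i != j ->
     star_commute (shift (L := L) (genv i)) (shift (L := L) (genv j)))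
  <-> one_coaligned L.
Proof.
split=> [star i j ij ei ej di dj eij | coal i j ij].
  have [w wr] : exists w : infpath L, fobj w 0%R = src ei.
    have [w e] := hL _ (deg_idm (src ei)).
    by exists w; rewrite -[LHS]rng_idm -iprangeE e rng_idm.
  (* A path [w] out of the common source turns the two edges into the first
     segments of infinite paths with a common tail. *)
  have [y []] := prepend (esym wr).
  rewrite di => yi yw.
  have [z []] := prepend (etrans (esym eij) (esym wr)).
  rewrite dj => zj zw.
  have yz : shift (genv i) y = shift (genv j) z by rewrite yw.
  have [_ /(_ y z yz)] := star i j ij.
  case/(lift_square_iff yz) => fg; rewrite yi zj => -[[d1 d2 [s1 s2 e]] u].
  exists fg; split=> // fg' [d1' d2' s1' s2' e'].
  by apply: u; split.
split=> [x | y z yz]; first exact: shiftC.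
apply/(lift_square_iff yz).
have [|fg [[d1 d2 s1 s2 e] u]] :=
    coal i j ij _ _ (deg_init y (genv i)) (deg_init z (genv j)).
  by rewrite !src_init -[LHS]fobj_shift -[RHS]fobj_shift yz.
exists fg; split=> // fg' [d1' d2' [s1' s2' e']].
by apply: u; split.
Qed.
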